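(* There exists an absolute constant $C>0$ such that the following holds for every integer $n\ge 1$. Let $K\subset\mathbb{R}^n$ be an origin-symmetric convex body and let $\Gamma\subset\mathbb{R}^n$ be a full-rank lattice. Then there exists an infinitely proper GAP $P$ in $\Gamma$ such that (1) $K\cap\Gamma\subseteq P$, and (2) $|P|\le (Cn)^{2n}\,|K\cap\Gamma|$.
   Context: A convex body is a compact convex subset of $\mathbb{R}^n$ with nonempty interior; it is origin-symmetric if $K=-K$. A full-rank lattice $\Gamma\subset\mathbb{R}^n$ is the set of integer linear combinations of $n$ linearly independent vectors of $\mathbb{R}^n$. A (symmetric) generalized arithmetic progression (GAP) of rank $d$ in $\Gamma$ is a set of the form $P=\{Az : z\in\mathbb{Z}^d,\ |z_i|\le b_i,\ 1\le i\le d\}$, where $A\in\mathbb{R}^{n\times d}$ is a matrix with columns $a_1,\dots,a_d\in\Gamma$ and $b=(b_1,\dots,b_d)\in\mathbb{R}_{>0}^d$ (a GAP is considered together with the data $A,b$). It is proper if $z\mapsto Az$ is injective on $\{z\in\mathbb{Z}^d: |z_i|\le b_i,\ 1\le i\le d\}$. For $t>0$, $P_t$ denotes the GAP with the same matrix $A$ and with each $b_i$ replaced by $tb_i$. $P$ is infinitely proper if $P_t$ is proper for every $t>0$; equivalently, the columns of $A$ are $\mathbb{Z}$-linearly independent. The size of an infinitely proper GAP is $|P|=\prod_{i=1}^d(2\lfloor b_i\rfloor+1)$, which is its cardinality as a set. $|K\cap\Gamma|$ denotes cardinality. *)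

(* Defs.v *)
From HB Require Import structures.
From mathcomp Require Import all_boot all_order all_algebra.
From mathcomp Require Import finmap.
From mathcomp Require Import all_classical all_reals all_analysis.

Set Implicit Arguments.
Unset Strict Implicit.
Unset Printing Implicit Defensive.

Import Order.TTheory GRing.Theory Num.Theory.
Import numFieldNormedType.Exports.

Local Open Scope classical_set_scope.
Local Open Scope ring_scope.

Definition convex_body (R : realType) (n : nat) (K : set 'cV[R]_n) : Prop :=
  [/\ compact K, convex_set (K : set (convex_lmodType 'cV[R]_n))
    & interior K !=set0].

Definition origin_symmetric (R : realType) (n : nat) (K : set 'cV[R]_n) : Prop :=
  K = -%R @` K.

Definition full_rank_lattice (R : realType) (n : nat) (G : set 'cV[R]_n) : Prop :=
  exists2 v : n.-tuple 'cV[R]_n, free v &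
    G = [set \sum_(i < n) v`_i *~ z i | z in [set: 'I_n -> int]].

(* The data (A, b) are part of a progression: distinct data may have the same
   underlying set. *)
Record gap (R : realType) (n : nat) (G : set 'cV[R]_n) := Gap {
  gap_rank : nat;
  gap_rank_gt0 : (0 < gap_rank)%N;
  gap_mx : 'M[R]_(n, gap_rank);
  gap_bound : 'cV[R]_gap_rank;
  gap_col_lattice : forall j, G (col j gap_mx);
  gap_bound_gt0 : forall i, 0 < gap_bound i 0
}.

Section GapTheory.
Context (R : realType) (n : nat) (G : set 'cV[R]_n).
Implicit Type P : gap G.

Definition gap_box P : set 'cV[int]_(gap_rank P) :=
  [set z : 'cV[int]_(gap_rank P) | forall i, `|(z i 0)%:~R| <= gap_bound P i 0].
Arguments gap_box : clear implicits.

Definition gap_eval P (z : 'cV[int]_(gap_rank P)) : 'cV[R]_n :=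
  gap_mx P *m map_mx intr z.
Arguments gap_eval : clear implicits.

Definition gap_set P : set 'cV[R]_n := gap_eval P @` gap_box P.

Definition gap_proper P : Prop := set_inj (gap_box P) (gap_eval P).

Lemma gap_dilate_bound_gt0 P (t : R) :
  0 < t -> forall i, 0 < (t *: gap_bound P) i 0.
Proof. by move=> t0 i; rewrite mxE mulr_gt0// gap_bound_gt0. Qed.

Definition gap_dilate P (t : R) (t0 : 0 < t) : gap G :=
  Gap (gap_rank_gt0 P) (@gap_col_lattice _ _ _ P)
      (gap_dilate_bound_gt0 (P := P) t0).

Definition gap_infinitely_proper P : Prop :=
  forall (t : R) (t0 : 0 < t), gap_proper (gap_dilate P t0).

(* This is the cardinality of [gap_set P] when [P] is proper. *)
Definition gap_size P : int :=
  \prod_(i < gap_rank P) (2 * Num.floor (gap_bound P i 0) + 1).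

End GapTheory.

Arguments gap_box {R n G} P _.
Arguments gap_eval {R n G} P z.

(* Main.v *)
Require Import Defs.
From HB Require Import structures.
From mathcomp Require Import all_boot all_order all_algebra.
From mathcomp Require Import finmap.
From mathcomp Require Import all_classical all_reals all_analysis.
From mathcomp Require Import perm zify ring lra.

Set Implicit Arguments.
Unset Strict Implicit.
Unset Printing Implicit Defensive.

Import Order.TTheory GRing.Theory Num.Theory.
Import numFieldNormedType.Exports.

Local Open Scope classical_set_scope.
Local Open Scope ring_scope.

(** In lattice coordinates [K `&` G] becomes a finite set [W] of integer vectors
    that contains every integer vector [\sum_i q_i w_i] with [w_i] in [W] and
    [\sum_i `|q_i| <= 1]. If [W] does not span, Smith normal form changes
    coordinates so that one of them vanishes on [W]; that coordinate gets the
    bound [1/2] and costs nothing, and the others are handled by induction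
    ([adapted_basis]). Suppose then that [W] spans [R^n].

    Maximising [\det M] over [M = \sum_w p_w w^T w], with [p] a probability
    weight on [W], replaces John's theorem ([near_optimal_design]): a near
    maximiser satisfies [w M^-1 w^T <= 4 n] on [W], as otherwise moving mass to
    [w] would increase the determinant too much, while the ellipsoid
    [y M^-1 y^T <= 1] consists of vectors [c M = \sum_w p_w <c, w> w] with
    [\sum_w p_w `|<c, w>| <= 1] ([ellipsoid_absconvex]), whose integer points
    therefore lie in [W].

    On integer forms [u] the norm dual to the ellipsoid is [u M u^T]. By
    Cauchy-Schwarz, a basis [u_1, ..., u_n] of the integer forms bounds the
    coordinates of [W] by [b_j] with [b_j ^ 2 = 4 n (u_j M u_j^T)]. Take a
    Korkine-Zolotarev basis: [u_1] nearly shortest, and recursively on the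
    Schur complement ([korkine_zolotarev]). This writes the Gram matrix as
    [L D L^T], with [L] unipotent. Let [R_i] be the largest [D_j], [j <= i].
    A nonzero lattice point with last nonzero coordinate [k] has, for each
    [j <= k], squared norm at least of the order of [D_j] after projection away
    from [u_1, ..., u_(j-1)] ([reduced]). So the box with half sides of order
    [sqrt (R_i / (n D_i))] contains no nonzero lattice point, and Minkowski's
    pigeonhole ([tiles_box_points]) gives
    [\prod_i R_i <= (16 n)^n \prod_i D_i]. As [u_i M u_i^T <= n R_i], the product
    of the [b_j ^ 2] is at most [(64 n^3)^n \prod_i D_i]
    ([reduced_diag_prod]).

    The same pigeonhole in the dual coordinates finds at least
    [\prod_i sqrt (D_i / (4 n))] integer points in the ellipsoid, hence in [W]:
    the box with half sides [sqrt (D_i / n)] lies in it. Comparing,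
    [\prod_j b_j <= (16 n^2)^n #|W|] ([full_rank_bound]). Finally [b_j >= 1]
    because [W] spans, so that rounding costs at most a factor [3] for each
    coordinate. *)

(** * Positive definite quadratic forms *)

Local Notation intmx := (map_mx intr).

Definition qf (R : realType) (n : nat) (A : 'M[R]_n) (x : 'rV[R]_n) : R :=
  (x *m A *m x^T) 0 0.

Definition posdef (R : realType) (n : nat) (A : 'M[R]_n) : Prop :=
  A^T = A /\ forall x, x != 0 -> 0 < qf A x.

Lemma qf_ge0 (R : realType) n (A : 'M[R]_n) x : posdef A -> 0 <= qf A x.
Proof.
move=> [_ Apos]; have [->|/Apos/ltW//] := eqVneq x 0.
by rewrite /qf !mul0mx mxE.
Qed.

Lemma qf_diag (R : realType) n (D : 'rV[R]_n) x :
  qf (diag_mx D) x = \sum_i D 0 i * x 0 i ^+ 2.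
Proof.
rewrite /qf mul_mx_diag mxE; apply: eq_bigr => i _.
by rewrite !mxE -mulrA mulrCA -expr2.
Qed.

Lemma qf_congr (R : realType) m n (A : 'M[R]_n) (B : 'M[R]_(m, n)) x :
  qf (B *m A *m B^T) x = qf A (x *m B).
Proof. by rewrite /qf trmx_mul !mulmxA. Qed.

Lemma qf_delta (R : realType) n (A : 'M[R]_n) i : qf A (delta_mx 0 i) = A i i.
Proof. by rewrite /qf -rowE trmx_delta -colE !mxE. Qed.

Lemma qfZ (R : realType) n (A : 'M[R]_n) c x : qf A (c *: x) = c ^+ 2 * qf A x.
Proof.
by rewrite /qf linearZ /= -!scalemxAl -scalemxAr scalerA mxE -expr2.
Qed.

Lemma posdef_unit (R : realType) n (A : 'M[R]_n) : posdef A -> A \in unitmx.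
Proof.
move=> [_ Apos]; rewrite -row_free_unit -kermx_eq0.
apply/eqP/row_matrixP => i; rewrite row0; apply: contrapT => /eqP/Apos.
by rewrite /qf -row_mul mulmx_ker row0 mul0mx mxE ltxx.
Qed.

Lemma posdef_congr (R : realType) n (A B : 'M[R]_n) :
  posdef A -> B \in unitmx -> posdef (B *m A *m B^T).
Proof.
move=> [Asym Apos] Bu; split; first by rewrite !trmx_mul trmxK Asym mulmxA.
move=> x x0; rewrite qf_congr Apos//; apply: contra_neq x0 => xB0.
by rewrite -[x](mulmxK Bu) xB0 mul0mx.
Qed.

Lemma posdef_inv (R : realType) n (A : 'M[R]_n) :
  posdef A -> posdef (invmx A).
Proof.
move=> Ap; have Au := posdef_unit Ap.
have := posdef_congr Ap (_ : invmx A \in unitmx).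
rewrite unitmx_inv => /(_ Au); rewrite mulVmx// mul1mx trmx_inv.
by case: Ap => ->.
Qed.

(** The Cauchy-Schwarz inequality for the form [A], applied to [x] and to
    [y A^-1]. *)
Lemma qf_cauchy_schwarz (R : realType) n (A : 'M[R]_n) (x y : 'rV[R]_n) :
  posdef A -> (x *m y^T) 0 0 ^+ 2 <= qf A x * qf (invmx A) y.
Proof.
move=> Ap; have Au := posdef_unit Ap; have [Asym _] := Ap.
set c := (x *m y^T) 0 0; set b := qf (invmx A) y.
have [y0|y0] := eqVneq y 0.
  by rewrite /c /b /qf y0 trmx0 !mul0mx !mulmx0 mxE expr0n mulr0.
have b0 : 0 < b by apply: (posdef_inv Ap).2.
set v := y *m invmx A.
have vT : v^T = invmx A *m y^T by rewrite trmx_mul trmx_inv Asym.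
have e1 : (x *m A *m v^T) 0 0 = c.
  by rewrite vT -mulmxA mulKVmx.
have e2 : (v *m A *m x^T) 0 0 = c.
  have -> : v *m A *m x^T = (x *m y^T)^T by rewrite /v mulmxKV// trmx_mul trmxK.
  by rewrite mxE.
have e3 : (v *m A *m v^T) 0 0 = b.
  by rewrite /v mulmxKV// vT mulmxA.
have : 0 <= qf A (b *: x - c *: v) by exact: qf_ge0.
have -> : qf A (b *: x - c *: v) =
    b * (b * qf A x - c * c) - c * (b * c - c * b).
  rewrite /qf; have -> : (b *: x - c *: v)^T = b *: x^T - c *: v^T.
    by rewrite linearB /= !linearZ.
  rewrite mulmxBl mulmxBr !mulmxBl -!scalemxAl -!scalemxAr.
  have subE (P Q : 'M[R]_1) : (P - Q) 0 0 = P 0 0 - Q 0 0 by rewrite !mxE.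
  have scE a (P : 'M[R]_1) : (a *: P) 0 0 = a * P 0 0 by rewrite mxE.
  rewrite !(subE, scE) e1 e2 e3; ring.
move=> h.
rewrite -subr_ge0 -(pmulr_rge0 _ b0).
suff -> : b * (qf A x * b - c ^+ 2) =
    b * (b * qf A x - c * c) - c * (b * c - c * b) by [].
ring.
Qed.

(** * Short primitive integer vectors *)
Lemma intmx_unit (R : realType) n (U : 'M[int]_n) :
  U \in unitmx -> (intmx U : 'M[R]_n) \in unitmx.
Proof. by move=> Uu; rewrite unitmxE det_map_mx rmorph_unit -?unitmxE. Qed.

Lemma entry_neq0 (T : nmodType) m n (z : 'M[T]_(m, n)) :
  z != 0 -> exists i j, z i j != 0.
Proof.
apply: contra_neqP => h; apply/matrixP => i j; rewrite mxE.
by apply: contrapT => /eqP zij; apply: h; exists i, j.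
Qed.

Lemma int_sqr_ge1 (R : realType) (k : int) : k != 0 -> 1 <= k%:~R ^+ 2 :> R.
Proof. by move=> k0; rewrite -rmorphXn /= ler1z; move: k0; lia. Qed.

(** The infimum of [qf A] over the nonzero integer vectors is positive, by
    Cauchy-Schwarz against the coordinate forms, so some vector comes within a
    factor [2] of it; for the reduction this is as good as a minimum. *)
Lemma approx_shortest (R : realType) n (A : 'M[R]_n.+1) : posdef A ->
  exists2 z : 'rV[int]_n.+1, z != 0 &
    forall y : 'rV[int]_n.+1, y != 0 ->
      qf A (intmx z) <= 2 * qf A (intmx y).
Proof.
move=> Ap; have Ap' := posdef_inv Ap.
pose Q := [set qf A (intmx z) | z in [set z : 'rV[int]_n.+1 | z != 0]].
pose c := 1 + \sum_i invmx A i i.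
have dpos i : 0 <= invmx A i i by rewrite -qf_delta qf_ge0.
have c0 : 0 < c by rewrite ltr_pwDl// sumr_ge0.
have lbQ : lbound Q c^-1.
  move=> _ [z z0 <-]; have [i [j zj]] := entry_neq0 z0.
  rewrite !ord1 in zj.
  have := qf_cauchy_schwarz (intmx z) (delta_mx 0 j) Ap.
  rewrite trmx_delta -colE !mxE qf_delta => /(le_trans (int_sqr_ge1 R zj)) h.
  rewrite -[leLHS]mul1r ler_pdivrMr//; apply: (le_trans h).
  apply: ler_wpM2l; first exact: qf_ge0.
  by rewrite /c (bigD1 j)//= addrCA lerDl addr_ge0// sumr_ge0.
have e0 : (delta_mx 0 0 : 'rV[int]_n.+1) != 0.
  by apply/eqP => /matrixP/(_ 0 0); rewrite !mxE !eqxx.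
have hQ : has_inf Q.
  by split; [exists (qf A (intmx (delta_mx 0 0))), (delta_mx 0 0) | exists c^-1].
have i0 : 0 < inf Q.
  apply: lt_le_trans (lb_le_inf hQ.1 lbQ); by rewrite invr_gt0.
have [_ [z z0 <-] hz] := inf_adherent i0 hQ.
exists z => // y y0; apply: (le_trans (ltW hz)).
have : inf Q <= qf A (intmx y) by apply: ge_inf; [exact: hQ.2|exists y].
lra.
Qed.

(** A near-minimal vector may be replaced by the primitive vector of which it is a
    multiple, and the Smith normal form of a row completes a primitive vector to
    a unimodular matrix. *)
Lemma approx_shortest_unimodular (R : realType) n (A : 'M[R]_n.+1) : posdef A ->
  exists2 U : 'M[int]_n.+1, U \in unitmx &
    forall y : 'rV[int]_n.+1, y != 0 ->
      qf A (intmx (row 0 U)) <= 2 * qf A (intmx y).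
Proof.
move=> Ap; have [z z0 hz] := approx_shortest Ap.
have [l lu [U Uu [s _ ez]]] := int_Smith_normal_form z.
exists U => // y /hz; apply: le_trans.
have {}ez : z = (l 0 0 * s`_0) *: row 0 U.
  rewrite {1}ez [l]mx11_scalar -mulmxA mul_scalar_mx -scalerA; congr (_ *: _).
    by rewrite mxE eqxx.
  rewrite rowE scalemxAl; congr (_ *m _); apply/matrixP => i j.
  rewrite !mxE !ord1 eqxx/=; case: (j == 0) / eqP => [->|]; first by rewrite mulr1.
  by move=> /eqP; rewrite eq_sym mulr0 -val_eqE /= => /negbTE ->.
set k : int := (_ * _) in ez.
have k0 : k != 0 by apply: contra_neq z0 => k0; rewrite ez k0 scale0r.
rewrite ez map_mxZ qfZ ler_peMl//; first exact: qf_ge0.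
exact: int_sqr_ge1.
Qed.

(** * Korkine-Zolotarev reduction *)

(** Gram matrix of the projection of the last [n] basis vectors to the orthogonal
    complement of the first one. *)
Definition schur (R : realType) n (A : 'M[R]_(1 + n)) : 'M[R]_n :=
  drsubmx A - (A 0 0)^-1 *: (dlsubmx A *m ursubmx A).

Lemma posdef_diag_gt0 (R : realType) n (A : 'M[R]_n) i : posdef A -> 0 < A i i.
Proof.
move=> [_ Ap]; rewrite -qf_delta Ap//; apply/eqP => /matrixP/(_ 0 i)/eqP.
by rewrite !mxE !eqxx oner_eq0.
Qed.

Lemma ulsubmx_11 (R : realType) n (A : 'M[R]_(1 + n)) : ulsubmx A = (A 0 0)%:M.
Proof.
by rewrite [LHS]mx11_scalar !mxE; congr (A _ _)%:M; apply: val_inj.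
Qed.

(** Clearing the first column by a unipotent congruence turns [A] into the block
    diagonal matrix of [A 0 0] and [schur A]. *)
Lemma posdef_schur (R : realType) n (A : 'M[R]_(1 + n)) :
  posdef A -> posdef (schur A).
Proof.
move=> Ap; have [Asym _] := Ap; have a0 := posdef_diag_gt0 0 Ap.
have dlT : (ursubmx A)^T = dlsubmx A by rewrite trmx_ursub Asym.
have urT : (dlsubmx A)^T = ursubmx A by rewrite -dlT trmxK.
pose E : 'M[R]_(1 + n) := block_mx 1%:M 0 (- (A 0 0)^-1 *: dlsubmx A) 1%:M.
have Eu : E \in unitmx by rewrite unitmxE det_lblock !det1 mulr1 unitr1.
have eE : E *m A *m E^T = block_mx (A 0 0)%:M 0 0 (schur A).
  rewrite -[in LHS](submxK A) ulsubmx_11 tr_block_mx !mulmx_block !trmx1 trmx0.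
  rewrite !linearZ /= urT !mul1mx !mul0mx !mulmx1 !mulmx0 !addr0 -!scalemxAl.
  rewrite mul_mx_scalar mul_scalar_mx !scalerA mulNr mulVf ?gt_eqF//.
  by rewrite !scaleN1r !addNr !mul0mx !scaler0 !add0r addrC scaleNr.
have := posdef_congr Ap Eu; rewrite eE => -[Ssym Spos]; split.
  by move: Ssym; rewrite tr_block_mx => /eq_block_mx[].
move=> y y0; have := Spos (row_mx 0 y); rewrite /qf mul_row_block tr_row_mx.
rewrite !mul0mx !mulmx0 !add0r mul_row_col trmx0 mulmx0 add0r; apply.
by apply: contra_neq y0; rewrite -row_mx0 => /eq_row_mx[].
Qed.

(** The translates of the half-open unit cube by the integer combinations of the
    rows of [P] cover the space. For the triangular matrices below this is the
    only trace of their determinant being [1] that the pigeonhole needs. *)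
Definition tiles (R : realType) (n : nat) (P : 'M[R]_n) : Prop :=
  forall y : 'rV[R]_n, exists w : 'rV[int]_n,
    forall i, 0 <= (y - intmx w *m P) 0 i < 1.

Lemma floor_gap (R : realType) (x : R) : 0 <= x - (Num.floor x)%:~R < 1.
Proof. by have := floor_itv x; rewrite rmorphD /=; lra. Qed.

Lemma tiles_lblock (R : realType) n (c : 'cV[R]_n) (P : 'M[R]_n) :
  tiles P -> tiles (block_mx 1%:M 0 c P : 'M[R]_(1 + n)).
Proof.
move=> tP y; have [w hw] := tP (rsubmx y).
pose k := Num.floor (lsubmx y 0 0 - (intmx w *m c) 0 0).
exists (row_mx k%:M w) => i.
rewrite map_row_mx mul_row_block mulmx1 mulmx0 add0r -[y]hsubmxK.
rewrite opp_row_mx add_row_mx.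
case: (split_ordP i) => j ->; last by rewrite row_mxEr.
rewrite row_mxEl ord1 map_scalar_mx opprD addrA [_ - _]addrAC.
have -> (u v t : 'M[R]_1) : (u - v - t) 0 0 = u 0 0 - v 0 0 - t 0 0.
  by rewrite !mxE.
by rewrite [_%:M _ _]mxE mulr1n; apply: floor_gap.
Qed.

Lemma tiles_ublock (R : realType) n (r : 'rV[R]_n) (P : 'M[R]_n) :
  tiles P -> tiles (block_mx 1%:M r 0 P : 'M[R]_(1 + n)).
Proof.
move=> tP y; pose k := Num.floor (lsubmx y 0 0).
have [w hw] := tP (rsubmx y - (k%:~R)%:M *m r).
exists (row_mx k%:M w) => i.
rewrite map_row_mx mul_row_block mulmx1 mulmx0 addr0 -[y]hsubmxK.
rewrite opp_row_mx add_row_mx map_scalar_mx.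
case: (split_ordP i) => j ->; last by rewrite row_mxEr opprD addrA.
rewrite row_mxEl ord1.
have -> (u v : 'M[R]_1) : (u - v) 0 0 = u 0 0 - v 0 0 by rewrite !mxE.
by rewrite [_%:M _ _]mxE mulr1n; apply: floor_gap.
Qed.

(** The rows of [L] are a lattice basis in the coordinates of its Gram-Schmidt
    orthogonalisation, whose vectors have squared norms [D_j]. The last condition
    says that the [j]-th one is shortest, up to the factor [2], in the lattice
    projected away from the first [j] basis vectors. *)
Definition reduced (R : realType) n (L : 'M[R]_n) (D : 'rV[R]_n) : Prop :=
  [/\ forall i, 0 < D 0 i,
      forall i j : 'I_n, (i < j)%N -> L i j = 0,
      forall i j, 0 <= L i j <= 1
    & forall (j : 'I_n) (z : 'rV[int]_n),
        (exists2 i : 'I_n, (j <= i)%N & z 0 i != 0) ->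
        D 0 j <= 2 * \sum_(i < n | (j <= i)%N) D 0 i * (intmx z *m L) 0 i ^+ 2].

(** The first row of the new basis is a nearly shortest vector; the others come
    from the reduction of the Schur complement, after which integer multiples of
    the first row bring the first column of [L] into [0, 1]. The inverse of [L]
    is obtained blockwise as well, so that both tiling statements follow by the
    same induction. *)
Lemma korkine_zolotarev (R : realType) n (A : 'M[R]_n) : posdef A ->
  exists (U : 'M[int]_n) (L : 'M[R]_n) (D : 'rV[R]_n),
  [/\ U \in unitmx, intmx U *m A *m (intmx U)^T = L *m diag_mx D *m L^T,
      L \in unitmx, reduced L D & tiles L /\ tiles (invmx L)^T].
Proof.
elim: n A => [|n IH] A Ap.
  exists 1%:M, 1%:M, 0; split.
  - exact: unitmx1.
  - by apply/matrixP => - [].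
  - exact: unitmx1.
  - by split=> -[].
  - by split=> y; exists 0 => -[].
have [V Vu hV] := approx_shortest_unimodular Ap.
have Vru : (intmx V : 'M[R]_n.+1) \in unitmx by exact: intmx_unit.
pose B : 'M[R]_(1 + n) := intmx V *m A *m (intmx V)^T.
have Bp : posdef B by exact: posdef_congr.
pose a := B 0 0; have a0 : 0 < a by exact: posdef_diag_gt0.
have ea : a = qf A (intmx (row 0 V)).
  by rewrite /a -qf_delta qf_congr -rowE map_row.
have [U [L [D [Uu eU Lu [Dpos Ltri L01 Lred] [tL tiL]]]]] := IH _ (posdef_schur Bp).
pose c0 := a^-1 *: (intmx U *m dlsubmx B).
pose k : 'cV[int]_n := map_mx Num.floor c0.
pose c := c0 - intmx k.
pose U' : 'M[int]_(1 + n) := block_mx 1%:M 0 (- k) U.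
pose L' : 'M[R]_(1 + n) := block_mx 1%:M 0 c L.
pose D' : 'rV[R]_(1 + n) := row_mx a%:M D.
have c01 i : 0 <= c i 0 <= 1.
  have := floor_gap (c0 i 0); rewrite /c /k !mxE => /andP[-> /ltW ->].
  by [].
have dlT : (ursubmx B)^T = dlsubmx B by rewrite trmx_ursub Bp.1.
have urT : (dlsubmx B)^T = ursubmx B by rewrite -dlT trmxK.
have eUV : intmx (U' *m V) *m A *m (intmx (U' *m V))^T
           = L' *m diag_mx D' *m L'^T.
  have -> : intmx (U' *m V) *m A *m (intmx (U' *m V))^T =
            intmx U' *m B *m (intmx U')^T.
    by rewrite /B map_mxM trmx_mul !mulmxA.
  set k' : 'cV[R]_n := intmx k; set u : 'M[R]_n := intmx U.
  have c0E : c0 = c + k' by rewrite subrK.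
  have udl : u *m dlsubmx B = a *: (c + k').
    by rewrite -c0E /c0 scalerA mulfV ?gt_eqF// scale1r.
  have uru : ursubmx B *m u^T = a *: (c^T + k'^T).
    by rewrite -urT -trmx_mul udl linearZ /= linearD.
  have udr : u *m drsubmx B *m u^T =
      L *m diag_mx D *m L^T + a *: ((c + k') *m (c^T + k'^T)).
    rewrite -eU /schur mulmxBr mulmxBl -scalemxAr -scalemxAl !mulmxA -/u udl.
    rewrite -[_ *m ursubmx B *m _]mulmxA uru.
    rewrite -scalemxAl -scalemxAr -/a scalerA mulVf ?gt_eqF//.
    by rewrite scale1r subrK.
  have -> : intmx U' = block_mx 1%:M 0 (- k') u :> 'M[R]_(1 + n).
    by rewrite map_block_mx map_mx1 map_mx0 map_mxN.
  rewrite -[B]submxK ulsubmx_11 -/a /L' /D' diag_mx_row.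
  have -> : diag_mx (a%:M : 'M[R]_1) = a%:M.
    by apply/matrixP => i j; rewrite !mxE !ord1 eqxx.
  rewrite !tr_block_mx !mulmx_block !trmx1 !trmx0 linearN /=.
  rewrite !(mul1mx, mul0mx, mulmx1, mulmx0, addr0, add0r).
  rewrite [(_ + _) *m u^T]mulmxDl uru udl udr !(mul_mx_scalar, mul_scalar_mx).
  rewrite [_ *m ursubmx B]mulNmx [(- (_ *m ursubmx B)) *m _]mulNmx.
  rewrite -[_ *m ursubmx B *m _]mulmxA uru -!scalerDr ![- _ + _]addrC !addrK.
  congr (block_mx _ _ _ _).
  rewrite mulmxN mulmxDl -!scalemxAl -!scalemxAr !mulmxDr scalerDr.
  rewrite [_ *m L^T + _]addrA addrK scalerDr !addrA [LHS]addrC !addrA subrr add0r.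
  by rewrite addrC.
have U'u : U' *m V \in unitmx.
  by rewrite unitmx_mul Vu unitmxE det_lblock det1 mul1r -unitmxE Uu.
have L'u : L' \in unitmx.
  by rewrite unitmxE det_lblock det1 mul1r -unitmxE Lu.
have iL' : invmx L' = block_mx 1%:M 0 (- invmx L *m c) (invmx L).
  apply: (can_inj (mulmxK L'u)); rewrite mulVmx// mulmx_block.
  rewrite !mul1mx !mul0mx !mulmx0 !mulmx1 mulVmx// !addr0 !add0r mulNmx addNr.
  exact: scalar_mx_block.
have eqf z : qf A (intmx z *m intmx (U' *m V)) =
    \sum_i D' 0 i * (intmx z *m L') 0 i ^+ 2.
  by rewrite -qf_congr eUV qf_congr qf_diag.
have red : @reduced R (1 + n) L' D'.
  split.
  - move=> i; case: (@split_ordP 1 n i) => j ->; rewrite /D'.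
    + by rewrite row_mxEl ord1 mxE mulr1n.
    + by rewrite row_mxEr.
  - move=> i j; rewrite /L'; case: (@split_ordP 1 n i) => i' ->;
      case: (@split_ordP 1 n j) => j' -> /=.
    + by rewrite !ord1.
    + by rewrite block_mxEur mxE.
    + by rewrite ord1.
    + by rewrite block_mxEdr ltn_add2l => /Ltri.
  - move=> i j; rewrite /L'; case: (@split_ordP 1 n i) => i' ->;
      case: (@split_ordP 1 n j) => j' ->.
    + by rewrite block_mxEul mxE !ord1 eqxx ler01 lexx.
    + by rewrite block_mxEur mxE lexx ler01.
    + by rewrite block_mxEdl ord1.
    + by rewrite block_mxEdr.
  move=> j z [i ji zi]; case: (@split_ordP 1 n j) ji => j' -> /=.
    move=> _; have -> : D' 0 (lshift n j') = a.
      by rewrite /D' row_mxEl ord1 mxE mulr1n.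
    rewrite ea; apply: le_trans (hV (z *m (U' *m V)) _) _.
      apply: contra_neq zi => zU; rewrite -[z](mulmxK U'u) zU mul0mx mxE.
      by [].
    rewrite map_mxM eqf ler_pM2l// (eq_bigl predT) ?lexx// => s.
    by rewrite ord1.
  rewrite {1}/D' row_mxEr; case: (@split_ordP 1 n i) zi => i' -> /=.
    by rewrite ord1.
  move=> zi; rewrite leq_add2l => ji.
  have := Lred j' (rsubmx z) (ex_intro2 _ _ i' ji _); rewrite mxE => /(_ zi).
  move=> /le_trans; apply; rewrite ler_pM2l//.
  rewrite [leRHS]big_split_ord /= [X in _ <= X + _]big_pred0; last by case=> -[].
  rewrite add0r; under [leRHS]eq_bigl do rewrite leq_add2l.
  apply: ler_sum => s _; rewrite /D' row_mxEr.
  rewrite /L' -{2}[z]hsubmxK map_row_mx mul_row_block row_mxEr mulmx0 add0r.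
  by rewrite lexx.
exists (U' *m V), L', D'; split => //.
split; first exact: tiles_lblock.
rewrite iL' (_ : (block_mx _ _ _ _)^T =
  block_mx 1%:M (- invmx L *m c)^T 0 (invmx L)^T); first exact: tiles_ublock.
by rewrite (tr_block_mx 1%:M) trmx1 trmx0.
Qed.

(** * A Minkowski theorem by pigeonhole *)

(** Pigeonhole in place of volume: [N ^ n] lattice points, one for each unit cell
    of a large cube, are distributed over at most [\prod_i (2 * N / a i)] boxes of
    sides [a i]; the differences of the points in a crowded box are the ones
    wanted. *)
Lemma tiles_box_points (R : realType) n (P : 'M[R]_n) (a : 'I_n -> R) :
  tiles P -> (forall i, 0 < a i) ->
  exists s : seq 'rV[int]_n,
    [/\ uniq s, forall w, w \in s -> forall i, `|(intmx w *m P) 0 i| < a i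
      & \prod_i (a i / 2) <= (size s)%:R].
Proof.
move=> tP a0.
(* Any [N >= a i] makes the rounding of [N / a i] cost a factor of at most [2]. *)
pose N := (Num.truncn (\sum_i a i)).+1.
have s0 : 0 <= \sum_i a i by apply: sumr_ge0 => i _; exact: ltW.
have aN i : a i <= N%:R.
  have /andP[_ /ltW] := truncn_itv s0; apply: le_trans.
  by rewrite (bigD1 i)//= lerDl sumr_ge0// => j _; exact: ltW.
have N0 : 0 < N%:R :> R by rewrite ltr0n.
pose T := {ffun 'I_n -> 'I_N}.
have /choice[w hw] (m : T) : exists w : 'rV[int]_n,
    forall i, 0 <= (m i)%:R - (intmx w *m P) 0 i < 1.
  have [w h] := tP (\row_i (m i)%:R); exists w => i.
  by have := h i; rewrite !mxE.
pose f (m : T) i := (intmx (w m) *m P) 0 i + 1.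
have f_itv (m : T) i : (m i)%:R < f m i <= (m i)%:R + 1.
  by have := hw m i; rewrite /f; lra.
have f0 (m : T) i : 0 <= f m i / a i.
  rewrite divr_ge0 ?(ltW (a0 i))//.
  by have /andP[/ltW + _] := f_itv m i; apply: le_trans.
have w_inj : injective w.
  move=> m m' e; apply/ffunP => i; apply: val_inj; apply/eqP.
  have := f_itv m i; have := f_itv m' i; rewrite /f e.
  move=> /andP[h1 h2] /andP[h3 h4]; rewrite eqn_leq.
  by apply/andP; split; rewrite -ltnS -(ltr_nat R) -natr1; lra.
pose K i := (Num.truncn (N%:R / a i)).+1.
have K_le i : (K i)%:R <= 2 * N%:R / a i.
  have aN1 : 1 <= N%:R / a i by rewrite ler_pdivlMr// mul1r.
  have /andP[+ _] := truncn_itv (le_trans ler01 aN1).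
  by rewrite /K -natr1; lra.
have cell_lt (m : T) i : (Num.truncn (f m i / a i) < K i)%N.
  rewrite ltnS; apply: le_truncn; rewrite ler_pM2r ?invr_gt0//.
  have /andP[_ /le_trans] := f_itv m i; apply.
  by rewrite natr1 ler_nat.
pose M := (\max_i K i)%N.
have KM i : (K i <= M)%N by exact: leq_bigmax.
pose cell (m : T) : {ffun 'I_n -> 'I_M.+1} :=
  [ffun i => inord (Num.truncn (f m i / a i))].
have cellE m i : cell m i = Num.truncn (f m i / a i) :> nat.
  by rewrite ffunE inordK// ltnS (leq_trans (ltnW (cell_lt m i))).
pose F i := [pred k : 'I_M.+1 | (k < K i)%N].
have cellF m : cell m \in family F.
  by apply/familyP => i; rewrite inE cellE.
have cardF : #|family F| = (\prod_i K i)%N.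
  rewrite card_family foldrE big_image; apply: eq_bigr => i _.
  rewrite -sum1_card -(big_ord_widen _ (fun=> 1%N)) ?sum1_card ?card_ord//.
  exact: leq_trans (KM i) _.
have [c hc] : exists c, (N ^ n <= \prod_i K i * #|[pred m | cell m == c]|)%N.
  pose c0 := cell [ffun=> ord0].
  exists [arg max_(c > c0) #|[pred m | cell m == c]|]%N.
  case: arg_maxnP => // c _ hc; rewrite -cardF -sum_nat_const.
  have <- : #|T| = (N ^ n)%N by rewrite card_ffun !card_ord.
  rewrite -sum1_card (partition_big cell (mem (family F))) //=.
  apply: leq_sum => d _; apply: leq_trans (hc d isT).
  by rewrite sum1_card.
pose fib := enum [pred m | cell m == c].
pose m0 : T := head [ffun=> ord0] fib.
exists [seq w m - w m0 | m <- fib]; split.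
- rewrite map_inj_uniq ?enum_uniq// => m m' /addIr; exact: w_inj.
- move=> _ /mapP[m mf ->] i.
  have m0f : m0 \in fib.
    by rewrite /m0; case: (fib) mf => // x y _; rewrite mem_head.
  have e : Num.truncn (f m i / a i) = Num.truncn (f m0 i / a i).
    rewrite -!cellE; move: mf m0f; rewrite !mem_enum !inE => /eqP -> /eqP ->.
    by [].
  have -> : (intmx (w m - w m0) *m P) 0 i = f m i - f m0 i.
    by rewrite map_mxB mulmxBl /f !mxE; ring.
  have := truncn_itv (f0 m i); have := truncn_itv (f0 m0 i); rewrite e -natr1.
  rewrite !ler_pdivlMr// !ltr_pdivrMr// mulrDl mul1r => /andP[h1 h2] /andP[h3 h4].
  by rewrite ltr_norml; apply/andP; split; lra.
rewrite size_map -cardE -(ler_pM2l (exprn_gt0 n N0)).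
have : (N ^ n)%:R <= (\prod_i K i * #|[pred m | cell m == c]|)%:R :> R.
  by rewrite ler_nat.
rewrite natrX natrM => h.
have pa : 0 <= \prod_i (a i / 2).
  by apply: prodr_ge0 => i _; rewrite divr_ge0// ltW.
rewrite [leLHS]mulrC. have := ler_wpM2l pa h; move=> /le_trans; apply.
rewrite mulrA ler_wpM2r// natr_prod -big_split /=.
rewrite -[in leRHS](card_ord n) -prodr_const; apply: ler_prod => i _.
have ai := a0 i; have ai2 : 0 <= a i / 2 by rewrite divr_ge0// ltW.
rewrite mulr_ge0//=.
have := ler_wpM2l ai2 (K_le i); move=> /le_trans; apply.
by rewrite le_eqVlt; apply/orP; left; apply/eqP; field; rewrite gt_eqF.
Qed.

(** * The orthogonality defect of a reduced basis *)

(** Suppose that [w] is not [0], let [k] be its last nonzero coordinate, and [j <= k]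
    the index that belongs to [k]. Each coordinate up to [k] contributes at most
    [D_j / (4 n)] to the squared norm of the projection of [w] away from the first
    [j] basis vectors, and the later ones nothing; but reducedness bounds this
    squared norm below by [D_j / 2]. *)
Lemma reduced_no_short (R : realType) n (L : 'M[R]_n) (D : 'rV[R]_n)
    (a : 'I_n -> R) (w : 'rV[int]_n) :
  reduced L D ->
  (forall i : 'I_n, exists2 j : 'I_n, (j <= i)%N & forall k : 'I_n, (k <= i)%N ->
     D 0 k * a k ^+ 2 <= D 0 j / (4 * n%:R)) ->
  (forall i, `|(intmx w *m L) 0 i| < a i) -> w = 0.
Proof.
move=> [Dpos Ltri _ Lred] ha wa; apply: contrapT => /eqP w0.
have [i0 [k0 wk0]] := entry_neq0 w0; rewrite ord1 in wk0.
have [k wk kmax] : exists2 k : 'I_n, w 0 k != 0 &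
    forall t : 'I_n, w 0 t != 0 -> (t <= k)%N.
  case: (arg_maxnP (P := fun k => w 0 k != 0) (@nat_of_ord n) wk0) => k.
  by exists k.
have [j jk hj] := ha k.
have n0 : 0 < n%:R :> R by rewrite ltr0n (leq_ltn_trans _ (ltn_ord k)).
have Dj := Dpos j.
have e0 : 0 <= D 0 j / (4 * n%:R) by rewrite divr_ge0 ?mulr_ge0 ?ltW.
have term i : D 0 i * (intmx w *m L) 0 i ^+ 2 <= D 0 j / (4 * n%:R).
  have [ik|ki] := leqP i k.
    apply: le_trans (hj i ik); rewrite ler_pM2l ?Dpos//.
    by have := wa i; rewrite ltr_norml => /andP[h1 h2]; nra.
  rewrite [X in X ^+ 2](_ : _ = 0) ?expr0n ?mulr0//.
  rewrite mxE big1// => t _; have [/kmax tk|] := boolP (w 0 t != 0).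
    by rewrite Ltri ?mulr0// (leq_ltn_trans tk).
  by rewrite negbK !mxE => /eqP ->; rewrite mul0r.
have := Lred j w (ex_intro2 _ _ k jk wk); apply/negP; rewrite -ltNge.
have : \sum_(i < n | (j <= i)%N) D 0 i * (intmx w *m L) 0 i ^+ 2 <=
    \sum_(i < n) D 0 j / (4 * n%:R).
  rewrite big_mkcond /=; apply: ler_sum => i _; case: ifP => // _.
rewrite sumr_const card_ord -[_ *+ n]mulr_natr.
have -> : D 0 j / (4 * n%:R) * n%:R = D 0 j / 4 by field; rewrite gt_eqF.
lra.
Qed.

(** With [peak i] the largest [D_j], [j <= i], the box with half sides
    [sqrt (peak i / (4 n D_i))] meets the lattice only in the origin, so that the
    pigeonhole bound limits its volume. This is Minkowski's second theorem for
    the numbers [peak i], without successive minima; the entries of [L] being at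
    most [1], the [i]-th basis vector has squared norm at most [n * peak i]. *)
Lemma reduced_diag_prod (R : realType) n (L : 'M[R]_n) (D : 'rV[R]_n) :
  reduced L D -> tiles L ->
  \prod_i (L *m diag_mx D *m L^T) i i <= (16 * n%:R ^+ 2) ^+ n * \prod_i D 0 i.
Proof.
move=> Lred tL; have [Dpos Ltri L01 _] := Lred.
have /choice[pk hpk] (i : 'I_n) : exists j : 'I_n, (j <= i)%N /\
    forall k : 'I_n, (k <= i)%N -> D 0 k <= D 0 j.
  case: (@Order.TotalTheory.arg_maxP _ _ _ i (fun j : 'I_n => (j <= i)%N)
    (fun j => D 0 j)) => //.
  by move=> j ji hj; exists j.
pose peak i := D 0 (pk i).
have n0 (i : 'I_n) : 0 < n%:R :> R.
  by rewrite ltr0n; apply: leq_ltn_trans (ltn_ord i).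
have n_neq0 (i : 'I_n) : n%:R != 0 :> R by rewrite gt_eqF ?n0.
pose r i := peak i / (4 * n%:R * D 0 i).
have r0 i : 0 < r i by rewrite /r divr_gt0 ?mulr_gt0 ?Dpos ?n0.
have a0 i : 0 < Num.sqrt (r i) by rewrite sqrtr_gt0.
have [s [us hs sz]] := tiles_box_points tL a0.
have s1 : (size s <= 1)%N.
  apply: (@uniq_leq_size _ _ [:: 0]) => // w /hs hw; rewrite inE; apply/eqP.
  apply: (reduced_no_short Lred _ hw) => i.
  have [pki pkmax] := hpk i; exists (pk i) => // k ki.
  rewrite (sqr_sqrtr (ltW (r0 _))) /r.
  have -> : D 0 k * (peak k / (4 * n%:R * D 0 k)) = peak k / (4 * n%:R).
    by field; rewrite ?gt_eqF ?Dpos ?n0.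
  rewrite ler_pM2r ?invr_gt0 ?mulr_gt0 ?n0//; apply: pkmax.
  exact: leq_trans (hpk k).1 ki.
have {}sz : \prod_i (Num.sqrt (r i) / 2) <= 1.
  by apply: le_trans sz _; rewrite (ler_nat _ _ 1).
have peak_le : \prod_i peak i <= \prod_i (16 * n%:R * D 0 i).
  have p0 : 0 <= \prod_i (16 * n%:R * D 0 i).
    by apply: prodr_ge0 => i _; rewrite !mulr_ge0 ?ltW ?Dpos ?n0.
  have -> : \prod_i peak i =
      \prod_i (16 * n%:R * D 0 i) * (\prod_i (Num.sqrt (r i) / 2)) ^+ 2.
    rewrite -prodrXl -big_split /=; apply: eq_bigr => i _.
    rewrite exprMn (sqr_sqrtr (ltW (r0 _))) /r.
    by field; rewrite ?n_neq0 ?gt_eqF ?Dpos.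
  rewrite -[leRHS]mulr1; apply: ler_wpM2l => //; apply: exprn_ile1 => //.
  by apply: prodr_ge0 => i _; rewrite divr_ge0 ?sqrtr_ge0.
apply: (@le_trans _ _ (\prod_i (n%:R * peak i))).
  apply: ler_prod => i _; rewrite -qf_delta qf_congr qf_diag.
  apply/andP; split.
    by apply: sumr_ge0 => j _; rewrite mulr_ge0 ?sqr_ge0 ?ltW ?Dpos.
  rewrite -[n in n%:R]card_ord mulr_natl -sumr_const; apply: ler_sum => j _.
  rewrite -rowE mxE; have [ji|ij] := leqP j i.
    apply: le_trans ((hpk i).2 _ ji); rewrite (ler_piMr (ltW (Dpos _)))//.
    by have /andP[? ?] := L01 i j; rewrite exprn_ile1.
  by rewrite Ltri// expr0n mulr0 ltW// Dpos.
rewrite big_split /= prodr_const card_ord.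
have -> : (16 * n%:R ^+ 2) ^+ n * \prod_i D 0 i =
    n%:R ^+ n * \prod_i (16 * n%:R * D 0 i).
  by rewrite big_split /= prodr_const card_ord !exprMn; ring.
by apply: ler_wpM2l => //; rewrite exprn_ge0.
Qed.

(** * Near-optimal weights and the inscribed ellipsoid *)
Definition moment (R : realType) m n (X : 'M[R]_(m, n)) (p : 'rV[R]_m) : 'M[R]_n :=
  X^T *m diag_mx p *m X.

Definition simplex (R : realType) m : set 'rV[R]_m :=
  [set p | (forall i, 0 <= p 0 i) /\ \sum_i p 0 i = 1].

(** Sylvester's identity, from the two block triangular factorisations of
    [block_mx 1 (- u) v 1]. *)
Lemma det_1_add_mul (R : realType) n (v : 'cV[R]_n) (u : 'rV[R]_n) :
  \det (1%:M + v *m u) = 1 + (u *m v) 0 0.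
Proof.
have e : block_mx 1%:M 0 v 1%:M *m block_mx 1%:M (- u) 0 (1%:M + v *m u) =
    block_mx (1%:M + u *m v) (- u) 0 1%:M *m block_mx 1%:M 0 v 1%:M.
  rewrite !mulmx_block !(mul1mx, mulmx1, mul0mx, mulmx0, addr0, add0r).
  by rewrite mulNmx mulmxN addrK addrC addrK.
have := congr1 (@determinant _ _) e.
rewrite !det_mulmx !det_lblock !det_ublock !det1 !mul1r !mulr1 => ->.
by rewrite det_mx11 !mxE eqxx.
Qed.

Lemma det_rank_one_update (R : realType) n (A : 'M[R]_n) (c : R) (u : 'rV[R]_n) :
  A \in unitmx ->
  \det (A + c *: (u^T *m u)) = \det A * (1 + c * qf (invmx A) u).
Proof.
move=> Au; have -> : A + c *: (u^T *m u) =
    A *m (1%:M + (c *: (invmx A *m u^T)) *m u).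
  rewrite mulmxDr mulmx1 -scalemxAl -scalemxAr -[_ *m u^T *m u]mulmxA.
  by rewrite mulKVmx.
rewrite det_mulmx det_1_add_mul; congr (_ * (1 + _)).
by rewrite -scalemxAr mxE mulmxA.
Qed.

Lemma moment_delta (R : realType) m n (X : 'M[R]_(m, n)) i :
  moment X (delta_mx 0 i) = (row i X)^T *m row i X.
Proof.
rewrite /moment rowE trmx_mul trmx_delta !mulmxA -[_ *m delta_mx i 0 *m _]mulmxA.
rewrite mul_delta_mx; congr (_ *m _ *m _); apply/matrixP => j k; rewrite !mxE.
case: (j =P k) => [<-|jk]; first by rewrite mulr1n andbb.
rewrite mulr0n; case: (j =P i) => //= ji; case: (k =P i) => // ki.
by case: jk; rewrite ji.
Qed.

Lemma momentD (R : realType) m n (X : 'M[R]_(m, n)) a b p q :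
  moment X (a *: p + b *: q) = a *: moment X p + b *: moment X q.
Proof.
by rewrite /moment linearD !linearZ /= mulmxDr mulmxDl -!scalemxAr -!scalemxAl.
Qed.

Lemma moment_det_bounded (R : realType) m n (X : 'M[R]_(m, n)) :
  exists B, forall p, simplex p -> `|\det (moment X p)| <= B.
Proof.
pose b := \sum_i \sum_j \sum_k `|X i j * X i k|.
exists (\sum_(s : {perm 'I_n}) \prod_(i < n) b) => p [p0 p1].
rewrite /determinant; apply: le_trans (ler_norm_sum _ _ _) _.
apply: ler_sum => s _; rewrite normrM normrX normrN1 expr1n mul1r normr_prod.
apply: ler_prod => j _; rewrite normr_ge0 /= /moment mul_mx_diag mxE.
apply: le_trans (ler_norm_sum _ _ _) _; apply: ler_sum => i _.
rewrite !mxE mulrAC normrM [ `|p 0 i|]ger0_norm//.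
apply: (@le_trans _ _ `|X i j * X i (s j)|).
  rewrite ler_piMr//; rewrite -p1 (bigD1 i)//= lerDl sumr_ge0//.
rewrite (bigD1 j)//= (bigD1 (s j))//= -addrA lerDl addr_ge0// ?sumr_ge0//.
by move=> t _; rewrite sumr_ge0.
Qed.

Lemma qf_moment (R : realType) m n (X : 'M[R]_(m, n)) p (z : 'rV[R]_n) :
  qf (moment X p) z = \sum_i p 0 i * (X *m z^T) i 0 ^+ 2.
Proof.
have -> : X *m z^T = (z *m X^T)^T by rewrite trmx_mul trmxK.
rewrite /moment -{2}[X]trmxK qf_congr qf_diag.
by apply: eq_bigr => i _; rewrite [(_^T) _ _]mxE.
Qed.

Lemma moment_posdef (R : realType) m n (X : 'M[R]_(m, n)) p :
  simplex p -> moment X p \in unitmx -> posdef (moment X p).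
Proof.
move=> [p0 _] Mu; split.
  by rewrite /moment !trmx_mul trmxK tr_diag_mx mulmxA.
move=> z z0; have h i : 0 <= p 0 i * (X *m z^T) i 0 ^+ 2.
  by rewrite mulr_ge0 ?sqr_ge0.
rewrite lt_neqAle qf_moment sumr_ge0 ?andbT//; apply: contra_neqN z0.
rewrite eq_sym psumr_eq0// => /allP hz.
apply: (can_inj (mulmxK Mu)); rewrite mul0mx /moment !mulmxA.
have -> : z *m X^T *m diag_mx p = 0; last by rewrite mul0mx.
apply/matrixP => i j; rewrite mul_mx_diag !mxE ord1.
have := hz j (mem_index_enum _); rewrite mulf_eq0 sqrf_eq0 /= => /orP[]/eqP.
  by move=> ->; rewrite mulr0.
move=> e; have -> : \sum_(k < n) z 0 k * X^T k j = (X *m z^T) j 0.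
  by rewrite mxE; apply: eq_bigr => k _; rewrite !mxE mulrC.
by rewrite e mul0r.
Qed.

Lemma bernoulli_ge (R : realType) (e : R) k :
  0 <= e <= 1 -> 1 - k%:R * e <= (1 - e) ^+ k.
Proof.
move=> /andP[e0 e1]; elim: k => [|k IH]; first by rewrite mul0r subr0 expr0.
rewrite exprS -natr1; apply: le_trans (ler_wpM2l _ IH); last by lra.
have : 0 <= k%:R :> R by []. nra.
Qed.

(** Any weight whose determinant exceeds [2/3] of the supremum will do. If row
    [i] violated the bound, then moving mass [1 / (2 n)] to it would multiply the
    determinant by at least [3/2]: the rescaling of the old weight costs at most a
    factor [2] by Bernoulli's inequality, and the rank-one update gains at least a
    factor [3]. *)
Lemma near_optimal_design (R : realType) m n (X : 'M[R]_(m, n)) :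
  (0 < n)%N -> (forall x : 'cV[R]_n, X *m x = 0 -> x = 0) ->
  exists2 p, simplex p & moment X p \in unitmx /\
    forall i, qf (invmx (moment X p)) (row i X) <= 4 * n%:R.
Proof.
move=> n0 Xinj.
have m0 : (0 < m)%N.
  rewrite lt0n; apply/eqP => m0; subst m.
  have : (const_mx 1 : 'cV[R]_n) = 0 by apply: Xinj; apply/matrixP => - [].
  by move=> /matrixP/(_ (Ordinal n0) 0)/eqP; rewrite !mxE oner_eq0.
pose E := [set `|\det (moment X p)| | p in @simplex R m].
pose u : 'rV[R]_m := const_mx m%:R^-1.
have m0R : m%:R != 0 :> R by rewrite pnatr_eq0 -lt0n.
have us : simplex u.
  split=> [i|]; first by rewrite mxE invr_ge0.
  under eq_bigr do rewrite mxE.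
  by rewrite sumr_const card_ord -[LHS]mulr_natr mulVf.
have uE : 0 < `|\det (moment X u)|.
  rewrite normr_gt0 -unitfE -unitmxE -unitmx_tr -row_free_unit -kermx_eq0.
  apply/eqP/row_matrixP => i; rewrite row0; set z := row i _.
  have zM : qf (moment X u) z = 0.
    rewrite /qf -mulmxA; have : z *m (moment X u)^T = 0.
      by rewrite /z -row_mul mulmx_ker row0.
    move=> /(congr1 trmx); rewrite trmx_mul trmxK trmx0 => ->.
    by rewrite mulmx0 mxE.
  have Xz : X *m z^T = 0.
    apply/matrixP => j k; rewrite ord1 [RHS]mxE; apply/eqP; rewrite -sqrf_eq0.
    have h t : 0 <= u 0 t * (X *m z^T) t 0 ^+ 2.
      by rewrite mulr_ge0 ?sqr_ge0// us.1.
    move/eqP: zM; rewrite qf_moment psumr_eq0// => /allP/(_ j (mem_index_enum _)).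
    by rewrite mulf_eq0 /= mxE invr_eq0 (negbTE m0R).
  by rewrite -[z]trmxK (Xinj _ Xz) trmx0.
have [B hB] := moment_det_bounded X.
have hE : has_sup E.
  by split; [exists `|\det (moment X u)|, u | exists B => _ [p ps <-]; exact: hB].
have supE : 0 < sup E.
  by apply: lt_le_trans uE _; apply: ub_le_sup; [exact: hE.2|exists u].
have sE3 : 0 < sup E / 3 by rewrite divr_gt0.
have [_ [p ps <-] hp] := sup_adherent sE3 hE.
have Mu : moment X p \in unitmx.
  rewrite unitmxE unitfE -normr_gt0; apply: le_lt_trans hp; lra.
exists p => //; split => // i; rewrite leNgt; apply/negP => ht.
set t := qf _ _ in ht.
have n1 : 1 <= n%:R :> R by rewrite ler1n.
pose e : R := (2 * n%:R)^-1.
have e0 : 0 < e by rewrite invr_gt0; lra.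
have en : n%:R * e = 2^-1 by rewrite /e; field; rewrite gt_eqF//; lra.
have e2 : e <= 2^-1 by rewrite -en; nra.
pose q := (1 - e) *: p + e *: delta_mx 0 i.
have qs : simplex q.
  have qE j : q 0 j = (1 - e) * p 0 j + e * (j == i)%:R.
    by rewrite !mxE eqxx.
  case: ps => p0 p1; split=> [j|].
    by rewrite qE addr_ge0 ?mulr_ge0//; lra.
  under eq_bigr do rewrite qE.
  rewrite big_split /= -!mulr_sumr p1 (bigD1 i)//= eqxx big1.
    by rewrite addr0 !mulr1 subrK.
  by move=> j /negbTE ->.
have e1 : 0 < 1 - e by lra.
have qE : `|\det (moment X q)| =
    (1 - e) ^+ n * `|\det (moment X p)| * (1 + e / (1 - e) * t).
  have -> : moment X q = (1 - e) *:
      (moment X p + (e / (1 - e)) *: ((row i X)^T *m row i X)).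
    rewrite momentD moment_delta scalerDr scalerA; congr (_ + _ *: _).
    by field; rewrite gt_eqF.
  rewrite detZ det_rank_one_update// !normrM.
  rewrite [ `|(1 - e) ^+ n|]ger0_norm ?exprn_ge0 ?ltW//.
  rewrite mulrA [ `|1 + _|]ger0_norm// addr_ge0// mulr_ge0 ?divr_ge0// ?ltW//.
  by apply: lt_trans ht; lra.
have q_le : `|\det (moment X q)| <= sup E.
  by apply: ub_le_sup; [exact: hE.2|exists q].
have bern : 2^-1 <= (1 - e) ^+ n.
  apply: le_trans (bernoulli_ge n _); first by rewrite en; lra.
  by apply/andP; split; lra.
have t3 : 3 <= 1 + e / (1 - e) * t.
  have h1 : 4 * n%:R * e = 2 by rewrite -mulrA en; lra.
  have h2 : e <= e / (1 - e) by rewrite ler_pdivlMr//; nra.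
  have h3 : 2 <= e * t by rewrite -h1 mulrC ler_pM2l// ltW.
  have h4 : e * t <= e / (1 - e) * t.
    by rewrite ler_wpM2r// ltW// (lt_trans _ ht)//; lra.
  lra.
have : 2^-1 * `|\det (moment X p)| * 3 <= sup E.
  have h0 : 0 <= 2^-1 * `|\det (moment X p)|.
    by apply: mulr_ge0; rewrite ?invr_ge0.
  have h1 := ler_wpM2r (normr_ge0 (\det (moment X p))) bern.
  by apply: le_trans q_le; rewrite qE; apply: (ler_pM h0 _ h1 t3).
lra.
Qed.

(** * Bases adapted to an absolutely convex set of integer vectors *)
Definition lattice_absconvex (R : realType) m n (X : 'M[int]_(m, n)) : Prop :=
  forall (y : 'rV[int]_n) (q : 'rV[R]_m), \sum_i `|q 0 i| <= 1 ->
    intmx y = q *m intmx X -> exists i, y = row i X.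

Lemma jensen_sqr (R : realType) m (p x : 'I_m -> R) :
  (forall i, 0 <= p i) -> \sum_i p i = 1 ->
  (\sum_i p i * x i) ^+ 2 <= \sum_i p i * x i ^+ 2.
Proof.
move=> p0 p1; set mu := \sum_i p i * x i.
have : 0 <= \sum_i p i * (x i - mu) ^+ 2.
  by apply: sumr_ge0 => i _; rewrite mulr_ge0 ?sqr_ge0.
suff -> : \sum_i p i * (x i - mu) ^+ 2 = \sum_i p i * x i ^+ 2 - mu ^+ 2.
  by rewrite subr_ge0.
rewrite (eq_bigr (fun i => p i * x i ^+ 2 - 2 * mu * (p i * x i) + mu ^+ 2 * p i));
  last by move=> i _; ring.
rewrite big_split big_split /= sumrN -!mulr_sumr p1 -/mu; ring.
Qed.

(** The vector [c M] is the combination of the rows [x_i] of [X] with coefficients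
    [p_i <c, x_i>]; the sum of their absolute values is at most [sqrt (c M c^T)],
    because [p] is a probability weight. *)
Lemma ellipsoid_absconvex (R : realType) m n (X : 'M[R]_(m, n)) p c :
  simplex p -> qf (moment X p) c <= 1 ->
  exists2 q : 'rV[R]_m, \sum_i `|q 0 i| <= 1 & c *m moment X p = q *m X.
Proof.
move=> [p0 p1] hc; exists (c *m X^T *m diag_mx p); last by rewrite /moment !mulmxA.
have -> : \sum_i `|(c *m X^T *m diag_mx p) 0 i| =
    \sum_i p 0 i * `|(X *m c^T) i 0|.
  apply: eq_bigr => i _; rewrite mul_mx_diag mxE normrM mulrC ger0_norm//.
  have -> : X *m c^T = (c *m X^T)^T by rewrite trmx_mul trmxK.
  by rewrite [(_^T) _ _]mxE.
rewrite -(@ler_pXn2r _ 2) ?nnegrE ?sumr_ge0//; last first.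
  by move=> i _; rewrite mulr_ge0.
rewrite expr1n; apply: le_trans (jensen_sqr _ p0 p1) _.
apply: le_trans hc; rewrite qf_moment; apply: ler_sum => i _.
by rewrite real_normK ?num_real.
Qed.

(** The reduced basis bounds the coordinates from above through the size of its
    vectors for [M], and the integer points of the dual ellipsoid, all of which
    are rows of [X], are numerous enough to pay for the bounds. *)
Lemma full_rank_bound (R : realType) m n (X : 'M[int]_(m, n)) :
  (0 < n)%N -> (forall x : 'cV[R]_n, intmx X *m x = 0 -> x = 0) ->
  lattice_absconvex R X ->
  exists2 U : 'M[int]_n, U \in unitmx & exists b : 'I_n -> R,
    [/\ forall j, 1 <= b j, forall i j, `|((X *m U) i j)%:~R| <= b j
      & \prod_j b j <= (16 * n%:R ^+ 2) ^+ n * m%:R].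
Proof.
move=> n0 Xinj Xconv.
have nR : 0 < n%:R :> R by rewrite ltr0n.
have nneq : n%:R != 0 :> R by rewrite gt_eqF.
have [p ps [Mu Mle]] := near_optimal_design n0 Xinj.
set Xr : 'M[R]_(m, n) := intmx X in Mu Mle Xinj.
set M := moment Xr p in Mu Mle.
have Mp : posdef M by exact: moment_posdef.
have [U [L [D [Uu eU Lu Lred [tL tiL]]]]] := korkine_zolotarev Mp.
have [Dpos _ _ _] := Lred.
have Uru : (intmx U : 'M[R]_n) \in unitmx by exact: intmx_unit.
pose d j := (L *m diag_mx D *m L^T) j j.
have dE j : d j = qf M (row j (intmx U)).
  by rewrite /d -eU -qf_delta qf_congr -rowE.
have d0 j : 0 <= d j by rewrite dE qf_ge0.
pose b j := Num.sqrt (4 * n%:R * d j).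
have b_ge i j : `|((X *m U^T) i j)%:~R| <= b j.
  have -> : ((X *m U^T) i j)%:~R = (row j (intmx U) *m (row i Xr)^T) 0 0 :> R.
    rewrite !mxE rmorph_sum /=; apply: eq_bigr => k _.
    by rewrite !mxE rmorphM mulrC.
  rewrite -sqrtr_sqr ler_wsqrtr//.
  apply: le_trans (qf_cauchy_schwarz _ _ Mp) _.
  by rewrite dE mulrC ler_wpM2r// ?Mle// qf_ge0.
exists U^T; first by rewrite unitmx_tr.
exists b; split=> //.
  move=> j; apply: contrapT => /negP; rewrite -ltNge => bj.
  (* A bound below [1] would make the integral form [row j U] vanish on [X]. *)
  have X0 : Xr *m (row j (intmx U))^T = 0.
    apply/matrixP => i k; rewrite ord1 [RHS]mxE.
    have -> : (Xr *m (row j (intmx U))^T) i 0 = ((X *m U^T) i j)%:~R.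
      rewrite !mxE rmorph_sum /=; apply: eq_bigr => t _.
      by rewrite !mxE rmorphM.
    have := le_lt_trans (b_ge i j) bj; rewrite -intr_norm ltrz1.
    by case: ((X *m U^T) i j) => [[|k']|k'].
  have : delta_mx 0 j = 0 :> 'rV[R]_n.
    apply: (can_inj (mulmxK Uru)); rewrite mul0mx -rowE.
    by rewrite -[LHS]trmxK (Xinj _ X0) trmx0.
  by move/matrixP/(_ 0 j)/eqP; rewrite !mxE !eqxx oner_eq0.
pose a i := Num.sqrt (D 0 i / n%:R).
have a0 i : 0 < a i by rewrite sqrtr_gt0 divr_gt0.
have [s [us hs sz]] := tiles_box_points tiL a0.
have sm : (size s <= m)%N.
  (* The coordinates of the box points refer to the basis dual to the rows of
     [U]; [g] returns to those of [X]. *)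
  pose g (w : 'rV[int]_n) := w *m (invmx U)^T.
  have g_inj : injective g.
    apply: (can_inj (g := mulmx^~ U^T)) => w.
    by rewrite /g -mulmxA -trmx_mul mulmxV// trmx1 mulmx1.
  rewrite -(size_map g) -[leqRHS](card_ord m) -(size_codom (fun i => row i X)).
  apply: uniq_leq_size; first by rewrite map_inj_uniq.
  move=> _ /mapP[w ws ->].
  pose v := intmx w *m (invmx L)^T.
  pose e : 'rV[R]_n := \row_i (v 0 i / D 0 i).
  (* Chosen so that [c M] is the point [g w]; then [c M c^T] is the sum of the
     [v_i ^ 2 / D_i]. *)
  pose c := e *m invmx L *m intmx U.
  have eD : e *m diag_mx D = v.
    apply/matrixP => i j; rewrite mul_mx_diag !ord1 mxE [e _ _]mxE divfK//.
    by rewrite gt_eqF.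
  have cM : c *m M = intmx (g w).
    apply: (can_inj (mulmxK (_ : (intmx U)^T \in unitmx))).
      by rewrite unitmx_tr.
    have -> : intmx (g w) *m (intmx U)^T = intmx w :> 'rV[R]_n.
      rewrite map_trmx -map_mxM /g -mulmxA -trmx_mul mulmxV// trmx1.
      by rewrite mulmx1.
    have -> : c *m M *m (intmx U)^T =
        e *m invmx L *m (intmx U *m M *m (intmx U)^T) by rewrite /c !mulmxA.
    rewrite eU !mulmxA mulmxKV// eD /v.
    by rewrite -mulmxA -trmx_mul mulmxV// trmx1 mulmx1.
  have cqf : qf M c <= 1.
    rewrite /c -qf_congr eU qf_congr mulmxKV// qf_diag.
    have -> : 1 = \sum_(i < n) n%:R^-1 :> R.
      by rewrite sumr_const card_ord -[RHS]mulr_natr mulVf.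
    apply: ler_sum => i _; rewrite mxE.
    have vi : v 0 i ^+ 2 <= D 0 i / n%:R.
      have := hs w ws i; rewrite -/v => vi.
      rewrite -[leRHS]sqr_sqrtr; last by rewrite divr_ge0// ltW.
      by move: vi; rewrite ltr_norml -/(a i) => /andP[]; nra.
    have -> : D 0 i * (v 0 i / D 0 i) ^+ 2 = v 0 i ^+ 2 / D 0 i.
      by field; rewrite gt_eqF.
    by rewrite ler_pdivrMr// mulrC.
  have [q q1 hq] := ellipsoid_absconvex ps cqf.
  have [i ->] := Xconv (g w) q q1 (etrans (esym cM) hq).
  exact: codom_f.
have m_ge : \prod_i (a i / 2) <= m%:R.
  by apply: le_trans sz _; rewrite ler_nat.
have prod_ge0 : 0 <= \prod_i (a i / 2).
  by apply: prodr_ge0 => i _; rewrite divr_ge0// ltW.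
have b_ge0 : 0 <= \prod_j b j by apply: prodr_ge0 => i _; rewrite sqrtr_ge0.
have bound_ge0 : 0 <= (16 * n%:R ^+ 2) ^+ n * m%:R :> R.
  by rewrite mulr_ge0// exprn_ge0// mulr_ge0// exprn_ge0.
rewrite -(@ler_pXn2r _ 2) ?nnegrE//.
have n4 : \prod_(i < n) (4 * n%:R) = (4 * n%:R) ^+ n :> R.
  by rewrite prodr_const card_ord.
have -> : (\prod_j b j) ^+ 2 = (4 * n%:R) ^+ n * \prod_j d j.
  rewrite -prodrXl -n4 -big_split /=.
  by apply: eq_bigr => j _; rewrite sqr_sqrtr// !mulr_ge0// ltW.
have DE : \prod_i D 0 i = (4 * n%:R) ^+ n * (\prod_i (a i / 2)) ^+ 2.
  rewrite -prodrXl -n4 -big_split /=.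
  apply: eq_bigr => j _; rewrite exprMn sqr_sqrtr; last by rewrite divr_ge0// ltW.
  by field; rewrite nneq.
have dle := reduced_diag_prod Lred tL; rewrite DE in dle.
have c4 : 0 <= (4 * n%:R) ^+ n :> R by rewrite exprn_ge0// mulr_ge0.
apply: (@le_trans _ _ ((4 * n%:R) ^+ n *
  ((16 * n%:R ^+ 2) ^+ n * ((4 * n%:R) ^+ n * (\prod_i (a i / 2)) ^+ 2)))).
  by rewrite ler_wpM2l.
have -> : (4 * n%:R) ^+ n *
  ((16 * n%:R ^+ 2) ^+ n * ((4 * n%:R) ^+ n * (\prod_i (a i / 2)) ^+ 2)) =
  ((16 * n%:R ^+ 2) ^+ n) ^+ 2 * (\prod_i (a i / 2)) ^+ 2.
  have <- : (4 * n%:R) ^+ n * (16 * n%:R ^+ 2) ^+ n * (4 * n%:R) ^+ n =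
      ((16 * n%:R ^+ 2) ^+ n) ^+ 2 :> R.
    by rewrite -!exprMn -exprM mulnC exprM; congr (_ ^+ n); ring.
  ring.
rewrite [leRHS]exprMn ler_wpM2l ?sqr_ge0//.
by rewrite ler_pXn2r ?nnegrE.
Qed.

(** The columns of the Smith normal form decide: a zero column is an integral form
    vanishing on all rows, already completed to a unimodular matrix, and if there
    is none [X] is injective over the reals, like its Smith form. *)
Lemma full_rank_or_zero_col (R : realType) m n (X : 'M[int]_(m, n.+1)) :
  (forall x : 'cV[R]_n.+1, intmx X *m x = 0 -> x = 0) \/
  exists2 V : 'M[int]_n.+1, V \in unitmx & forall i, (X *m V) i 0 = 0.
Proof.
have [L Lu [T Tu [s _ eX]]] := int_Smith_normal_form X.
set Delta := (\matrix_(i, j) _ : 'M[int]_(m, n.+1)) in eX.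
have [[j hj]|h] := EM (exists j, forall i, Delta i j = 0).
  right; exists (invmx T *m tperm_mx j 0).
    by rewrite unitmx_mul unitmx_inv Tu unitmx_perm.
  move=> i; rewrite eX mulmxA mulmxK// -xcolE mxE tpermR mxE big1// => k _.
  by rewrite hj mulr0.
left=> x Xx; have Tru : (intmx T : 'M[R]_n.+1) \in unitmx by exact: intmx_unit.
have Lru : (intmx L : 'M[R]_m) \in unitmx by exact: intmx_unit.
have Dx : (intmx Delta : 'M[R]_(m, n.+1)) *m (intmx T *m x) = 0.
  apply: (can_inj (mulKmx Lru)); rewrite mulmx0 -Xx eX !map_mxM /= !mulmxA.
  by [].
suff Tx : intmx T *m x = 0 by rewrite -[x](mulKmx Tru) Tx mulmx0.
apply/matrixP => j k; rewrite ord1 [RHS]mxE.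
have [i Dij] : exists i, Delta i j != 0.
  apply: contrapT => hj; apply: h; exists j => i; apply: contrapT => /eqP ij.
  by apply: hj; exists i.
have ij : i = j :> nat.
  apply/eqP; apply: contraNT Dij => /negbTE ij.
  by rewrite mxE ij /= mulr0n.
have /matrixP/(_ i 0) := Dx; rewrite [LHS]mxE (bigD1 j)//= big1 => [|t tj].
  rewrite addr0 [RHS]mxE => /eqP; rewrite mulf_eq0 mxE intr_eq0 (negbTE Dij).
  by move=> /eqP.
rewrite [intmx Delta _ _]mxE [Delta _ _]mxE ij eq_sym val_eqE (negbTE tj).
by rewrite mulr0n mul0r.
Qed.

(** Induction on the dimension while some integral form vanishes on all rows; such a
    form is a coordinate with bound [1/2], contributing the factor [1]. *)
Lemma adapted_basis (R : realType) m n (X : 'M[int]_(m, n)) :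
  (0 < m)%N -> lattice_absconvex R X ->
  exists2 U : 'M[int]_n, U \in unitmx & exists b : 'I_n -> R,
    [/\ forall j, 0 < b j, forall i j, `|((X *m U) i j)%:~R| <= b j
      & \prod_j (2 * (Num.floor (b j))%:~R + 1 : R) <=
          (48 * n%:R ^+ 2) ^+ n * m%:R].
Proof.
move=> m0; elim: n X => [|n IH] X Xconv.
  exists 1%:M; first exact: unitmx1.
  exists (fun=> 1); split=> [[]|i []|] //.
  by rewrite big_ord0 expr0 mul1r ler1n.
have [Xinj|[V Vu V0]] := full_rank_or_zero_col R X.
  have [//|U Uu [b [b1 hb bprod]]] := full_rank_bound _ Xinj Xconv.
  exists U => //; exists b; split=> // [j|]; first exact: lt_le_trans (b1 j).
  apply: (@le_trans _ _ (\prod_j (3 * b j))).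
    apply: ler_prod => j _; have b1j := b1 j.
    have f1 : 1 <= (Num.floor (b j))%:~R :> R.
      by rewrite ler1z (floor_ge_int (b j) 1).
    have := floor_itv (b j) => /andP[fb _].
    by apply/andP; split; lra.
  rewrite big_split /= prodr_const card_ord.
  have -> : (48 * n.+1%:R ^+ 2) ^+ n.+1 =
      3 ^+ n.+1 * (16 * n.+1%:R ^+ 2) ^+ n.+1 :> R.
    by rewrite -exprMn; congr (_ ^+ _); ring.
  by rewrite -mulrA ler_wpM2l// exprn_ge0.
pose Y : 'M[int]_(m, 1 + n) := X *m V.
pose X' : 'M[int]_(m, n) := rsubmx Y.
have eY : Y = row_mx 0 X'.
  rewrite -[LHS]hsubmxK; congr row_mx; apply/matrixP => i j.
  rewrite !mxE (_ : lshift n j = 0); last by apply: val_inj; rewrite ord1.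
  by have := V0 i; rewrite mxE.
have X'conv : lattice_absconvex R X'.
  move=> y q q1 hy.
  have hY : intmx (row_mx 0 y : 'rV[int]_(1 + n)) = q *m intmx Y.
    by rewrite eY !map_row_mx mul_mx_row hy !map_mx0 mulmx0.
  have hX : intmx ((row_mx 0 y : 'rV[int]_(1 + n)) *m invmx V) = q *m intmx X.
    by rewrite map_mxM hY /= -mulmxA -map_mxM mulmxK.
  have [i hi] := Xconv _ q q1 hX.
  exists i; have := congr1 (fun z => z *m V) hi; rewrite mulmxKV// -row_mul.
  rewrite -/Y eY => /(congr1 (fun z : 'rV[int]_(1 + n) => rsubmx z)).
  rewrite row_mxKr => ->; apply/rowP => k; rewrite 2!mxE [RHS]mxE.
  exact: (@row_mxEr _ m 1 n).
have [U Uu [b [b0 hb bprod]]] := IH X' X'conv.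
exists (V *m (block_mx 1%:M 0 0 U : 'M[int]_(1 + n))).
  have Wu : (block_mx 1%:M 0 0 U : 'M[int]_(1 + n)) \in unitmx.
    by rewrite unitmxE det_ublock det1 mul1r -unitmxE.
  by rewrite unitmx_mul Vu; exact: Wu.
pose b' (j : 'I_(1 + n)) := if fintype.split j is inr k then b k else 2^-1.
have b'l k : b' (lshift n k) = 2^-1.
  by rewrite /b' (unsplitK (inl _ k)).
have b'r k : b' (rshift 1 k) = b k.
  by rewrite /b' (unsplitK (inr _ k)).
have eXU : X *m (V *m (block_mx 1%:M 0 0 U : 'M[int]_(1 + n))) = row_mx 0 (X' *m U).
  have : Y *m block_mx 1%:M 0 0 U = row_mx 0 (X' *m U).
    by rewrite eY mul_row_block !mul0mx !mulmx0 !add0r.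
  by rewrite mulmxA.
exists b'; split.
- move=> j; case: (@split_ordP 1 n j) => k ->.
  + by rewrite b'l invr_gt0.
  + by rewrite b'r.
- move=> i j; rewrite eXU; case: (@split_ordP 1 n j) => k ->.
  + by rewrite (@row_mxEl _ m 1 n) b'l mxE normr0 invr_ge0.
  + by rewrite (@row_mxEr _ m 1 n) b'r.
rewrite (@big_split_ord _ _ _ 1 n) /= big_ord1 b'l.
have -> : Num.floor (2^-1 : R) = 0.
  by apply: floor_def; rewrite add0r invr_ge0 ler0n invf_lt1 ?ltr1n.
rewrite mulr0 add0r mul1r; under eq_bigr do rewrite b'r.
apply: le_trans bprod _; rewrite ler_wpM2r//.
have nn : 0 <= n%:R :> R by [].
apply: (@le_trans _ _ ((48 * n.+1%:R ^+ 2) ^+ n)).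
  rewrite lerXn2r ?nnegrE ?mulr_ge0 ?exprn_ge0 ?ler0n//.
  by rewrite ler_wpM2l// lerXn2r ?nnegrE// ler_nat.
rewrite [leRHS]exprS ler_peMl ?exprn_ge0 ?mulr_ge0 ?exprn_ge0 ?ler0n//.
by rewrite -natr1; nra.
Qed.

(** * Lattice points of a symmetric convex body *)

(** A combination with coefficients [q i] is [\sum_i `|q i|] times a point of [K],
    by induction on the number of terms. *)
Lemma convex_symmetric_absconvex (R : realType) n (K : set 'cV[R]_n) :
  convex_set (K : set (convex_lmodType 'cV[R]_n)) -> origin_symmetric K ->
  K !=set0 -> forall m (x : 'I_m -> 'cV[R]_n) (q : 'I_m -> R),
    (forall i, K (x i)) -> \sum_i `|q i| <= 1 -> K (\sum_i q i *: x i).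
Proof.
move=> Kconv Ksym [k0 Kk0].
have KN y : K y -> K (- y) by move=> Ky; rewrite Ksym; exists y.
have Kseg (y z : 'cV[R]_n) t : K y -> K z -> 0 <= t <= 1 ->
    K (t *: y + (1 - t) *: z).
  move=> Ky Kz /andP[t0 t1].
  have := Kconv y z (Itv01 t0 t1); rewrite !inE; exact.
have K0 : K 0.
  have := Kseg _ _ 2^-1 Kk0 (KN _ Kk0).
  rewrite scalerN -scalerBl (_ : 2^-1 - (1 - 2^-1) = 0) ?scale0r; last by field.
  by apply; lra.
have cone m (x : 'I_m -> 'cV[R]_n) (q : 'I_m -> R) : (forall i, K (x i)) ->
    exists2 k, K k & \sum_i q i *: x i = (\sum_i `|q i|) *: k.
  elim: m x q => [|m IH] x q Kx.
    by exists 0 => //; rewrite !big_ord0 scaler0.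
  have [k Kk hk] := IH _ (fun i => q (widen_ord (leqnSn m) i))
    (fun i => Kx (widen_ord (leqnSn m) i)).
  rewrite !big_ord_recr /= hk; set s := \sum_(i < m) _; set c := q ord_max.
  have [y Ky ey] : exists2 y, K y & c *: x ord_max = `|c| *: y.
    have [c0|c0] := leP 0 c; first by exists (x ord_max); rewrite ?ger0_norm.
    by exists (- x ord_max); [exact: KN|rewrite ltr0_norm// scaleNr scalerN opprK].
  have s0 : 0 <= s by apply: sumr_ge0.
  rewrite ey; have c0 := normr_ge0 c; have [sc|sc] := eqVneq (s + `|c|) 0.
    have [-> ->] : s = 0 /\ `|c| = 0 by split; lra.
    by exists 0; rewrite ?scale0r ?addr0 ?scale0r.
  have sc0 : 0 < s + `|c| by rewrite lt_neqAle eq_sym sc addr_ge0.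
  exists ((s / (s + `|c|)) *: k + (1 - s / (s + `|c|)) *: y).
    apply: Kseg => //; rewrite divr_ge0 ?addr_ge0//= ler_pdivrMr//; lra.
  by rewrite scalerDr !scalerA; congr (_ *: _ + _ *: _); field.
move=> m x q Kx hq; have [k Kk ->] := cone m x q Kx.
have := Kseg k 0 (\sum_i `|q i|) Kk K0; rewrite scaler0 addr0; apply.
by rewrite hq sumr_ge0.
Qed.

Lemma full_rank_latticeE (R : realType) n (G : set 'cV[R]_n) :
  full_rank_lattice G -> exists2 B : 'M[R]_n, B \in unitmx &
    forall x, G x <-> exists z : 'cV[int]_n, x = B *m intmx z.
Proof.
move=> [v vfree ->]; pose B : 'M[R]_n := \matrix_(i, j) v`_j i 0.
have BE (x : 'cV[R]_n) : B *m x = \sum_j x j 0 *: v`_j.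
  apply/matrixP => i k; rewrite ord1 mxE summxE; apply: eq_bigr => j _.
  by rewrite !mxE mulrC.
exists B.
  rewrite -unitmx_tr -row_free_unit -kermx_eq0; apply/eqP/row_matrixP => i.
  rewrite row0; set y := row i _.
  have yB : B *m y^T = 0.
    by rewrite -[LHS]trmxK trmx_mul trmxK /y -row_mul mulmx_ker row0 trmx0.
  apply/matrixP => k j; rewrite ord1 [RHS]mxE.
  have /freeP/(_ (fun j => y 0 j)) := vfree; apply.
  apply: etrans yB; rewrite BE; apply: eq_bigr => t _.
  by rewrite [(_^T) _ _]mxE.
move=> x; split=> [[z _ <-]|[z ->]].
  exists (\col_j z j); rewrite BE; apply: eq_bigr => j _.
  by rewrite !mxE scaler_int.
exists (fun j => z j 0) => //; rewrite BE; apply: eq_bigr => j _.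
by rewrite mxE scaler_int.
Qed.

(** The inverse of [B] bounds the integer coordinates of the points of a bounded
    set. *)
Lemma finite_lattice_points (R : realType) n (K : set 'cV[R]_n) (B : 'M[R]_n) :
  compact K -> B \in unitmx ->
  finite_set (K `&` [set B *m intmx z | z in [set: 'cV[int]_n]]).
Proof.
move=> Kc Bu; have [M [_ /(_ (M + 1))]] := compact_bounded Kc.
rewrite ltrDl ltr01 => /(_ isT) hM.
have coord x j : K x -> `|x j 0| <= M + 1.
  move=> /hM; apply: le_trans.
  rewrite [leRHS]/Num.norm /= mx_normrE; apply/bigmax_geP; right => /=.
  by exists (j, 0).
pose c := \sum_i \sum_j `|invmx B i j| * `|M + 1|.
pose N := (Num.truncn c).+1.
pose f (g : {ffun 'I_n -> 'I_(N + N).+1}) : 'cV[R]_n :=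
  B *m intmx (\col_i ((g i)%:Z - N%:Z)).
apply: (@sub_finite_set _ _ (f @` setT)); last exact/finite_image/finite_finset.
move=> x [Kx [z _ ex]]; rewrite -ex in Kx *.
have c0 : 0 <= c by apply: sumr_ge0 => i _; apply: sumr_ge0.
have zN i : `|z i 0| <= N%:Z.
  have zc : `|(z i 0)%:~R| <= c.
    have -> : (z i 0)%:~R = (invmx B *m (B *m intmx z)) i 0 :> R.
      by rewrite mulKmx// mxE.
    rewrite mxE; apply: le_trans (ler_norm_sum _ _ _) _.
    rewrite /c [leRHS](bigD1 i)//= -[leLHS]addr0 lerD//; last first.
      by apply: sumr_ge0 => k _; apply: sumr_ge0.
    apply: ler_sum => j _; rewrite normrM ler_wpM2l//.
    exact: le_trans (coord _ _ Kx) (ler_norm _).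
  have /andP[_ cN] := truncn_itv c0.
  rewrite -(ler_int R) intr_norm; apply: le_trans zc _; exact: ltW.
exists [ffun i => inord (absz (z i 0 + N%:Z))] => //; congr (_ *m map_mx _ _).
apply/matrixP => i j; rewrite ord1 mxE ffunE inordK; first by have := zN i; lia.
by have := zN i; lia.
Qed.

Theorem theorem1p4 (R : realType) :
  exists2 C : R, 0 < C &
  forall (n : nat), (1 <= n)%N ->
  forall (K G : set 'cV[R]_n),
    convex_body K -> origin_symmetric K -> full_rank_lattice G ->
    exists P : gap G,
      [/\ gap_infinitely_proper P,
          K `&` G `<=` gap_set P
        & (gap_size P)%:~R
            <= (C * n%:R) ^+ (2 * n) * (#|` fset_set (K `&` G)|)%:R].
Proof.
exists 7 => // n n0 K G [Kc Kconv [k0 /interior_subset Kk0]] Ksym Gfull.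
have [B Bu GE] := full_rank_latticeE Gfull.
have Kcomb := convex_symmetric_absconvex Kconv Ksym (ex_intro _ k0 Kk0).
have KGfin : finite_set (K `&` G).
  apply: sub_finite_set (finite_lattice_points Kc Bu) => x [Kx /GE[z xz]].
  by split=> //; exists z.
set F := fset_set (K `&` G); set m := #|` F|.
have FP x : x \in F <-> K x /\ G x by rewrite in_fset_set// inE.
have intmx_inj p q : injective (fun z : 'M[int]_(p, q) => intmx z : 'M[R]_(p, q)).
  move=> y z /matrixP yz; apply/matrixP => i j.
  by have := yz i j; rewrite !mxE => /intr_inj.
pose pt (i : 'I_m) : 'cV[R]_n := F`_i.
have ptF i : pt i \in F by exact: mem_nth.
have /choice[w hw] (i : 'I_m) : exists w : 'rV[int]_n, pt i = B *m (intmx w)^T.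
  have [_ /GE[z ->]] := (FP _).1 (ptF i).
  by exists z^T; rewrite map_trmx trmxK.
pose X : 'M[int]_(m, n) := \matrix_i w i.
have rowX i : row i X = w i by rewrite rowK.
have FX x : x \in F -> exists i, x = B *m (intmx (row i X))^T.
  move=> xF; have xm : (index x F < m)%N by rewrite index_mem.
  by exists (Ordinal xm); rewrite rowX -hw /pt /= nth_index.
have Xconv : lattice_absconvex R X.
  move=> y q q1 hy; have yB : B *m (intmx y)^T = \sum_i q 0 i *: pt i.
    rewrite hy trmx_mul mulmxA; apply/matrixP => i j; rewrite ord1 summxE mxE.
    apply: eq_bigr => k _; rewrite hw !mxE mulrC; congr (_ * _).
    by apply: eq_bigr => l _; rewrite !mxE.
  have : B *m (intmx y)^T \in F.
    apply/FP; split.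
      by rewrite yB; apply: Kcomb => // i; have [] := (FP _).1 (ptF i).
    by apply/GE; exists y^T; rewrite map_trmx.
  move=> /FX[i /(can_inj (mulKmx Bu))/trmx_inj/intmx_inj yi].
  by exists i.
have m0 : (0 < m)%N.
  rewrite cardfs_gt0; apply/fset0Pn; exists 0; apply/FP; split.
    have := Kcomb 0%N (fun=> k0) (fun=> 0) (fun=> Kk0).
    by rewrite !big_ord0; apply; rewrite ler01.
  by apply/GE; exists 0; rewrite map_mx0 mulmx0.
have [U Uu [b [b0 hb bprod]]] := adapted_basis m0 Xconv.
pose V := (invmx U)^T; pose A := B *m intmx V.
have Vu : V \in unitmx by rewrite unitmx_tr unitmx_inv.
have Au : A \in unitmx by rewrite unitmx_mul Bu intmx_unit.
have A_G j : G (col j A).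
  by apply/GE; exists (col j V); rewrite /A colE -mulmxA -colE map_col.
have b0' i : 0 < (\col_j b j : 'cV[R]_n) i 0 by rewrite mxE.
pose P : gap G := Gap n0 A_G b0'.
exists P; split.
- move=> t t0 y z _ _; rewrite /gap_eval /=.
  by move=> /(can_inj (mulKmx Au))/intmx_inj.
- move=> x xKG; have /FX[i ->] : x \in F by exact/FP.
  exists (row i X *m U)^T => [j|].
    by rewrite mxE [X in _ <= X]mxE -row_mul mxE.
  rewrite /gap_eval /= /A -map_trmx map_mxM trmx_mul /V -map_trmx -mulmxA.
  congr (_ *m _); rewrite mulmxA -trmx_mul -map_mxM mulmxV//.
  by rewrite map_mx1 trmx1 mul1mx.
have -> : (gap_size P)%:~R = \prod_j (2 * (Num.floor (b j))%:~R + 1) :> R.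
  rewrite /gap_size rmorph_prod; apply: eq_bigr => j _.
  by rewrite /= mxE rmorphD rmorphM.
apply: le_trans bprod _; rewrite ler_wpM2r// exprM.
rewrite lerXn2r ?nnegrE ?mulr_ge0 ?exprn_ge0 ?mulr_ge0//.
by rewrite exprMn ler_wpM2r ?exprn_ge0//; lra.
Qed.
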